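(* Let $n\ge1$, let $(C,\psi_C)$ be a Coder pair, and let $\Omega_t=(\Delta_t,\psi_t)$, with $\Delta_t=\sum_{i=0}^n\Delta_it^i$ and $\psi_t=\sum_{i=0}^n\psi_it^i$, be a deformation of order $n$ of $(C,\psi_C)$. Define $$\mathrm{Ob}_C^3=\sum_{\substack{i+j=n+1\\ i,j>0}}\Big((\Delta_i\otimes\mathrm{Id}_C)\circ\Delta_j-(\mathrm{Id}_C\otimes\Delta_i)\circ\Delta_j\Big),$$ $$\mathrm{Ob}_\psi^2=\sum_{\substack{i+j=n+1\\ i,j>0}}\Big(\Delta_i\circ\psi_j-(\mathrm{Id}_C\otimes\psi_i)\circ\Delta_j-(\psi_i\otimes\mathrm{Id}_C)\circ\Delta_j\Big).$$ Then the $3$-cochain $\mathrm{Ob}_\Omega=(\mathrm{Ob}_C^3,\mathrm{Ob}_\psi^2)\in C^3_{\mathrm{Coder}}(C,C)$ is a $3$-cocycle of the Coder pair $(C,\psi_C)$ with coefficients in itself, i.e. $d_c^3(\mathrm{Ob}_C^3,\mathrm{Ob}_\psi^2)=0$.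
   Context: Everything is over a field $\mathbb{F}$ of characteristic $0$ (vector spaces, linear maps, $\otimes$, $\mathrm{Hom}$). A coassociative coalgebra is a pair $(C,\Delta)$ with $C$ a vector space and $\Delta:C\to C\otimes C$ linear such that $(\mathrm{Id}_C\otimes\Delta)\circ\Delta=(\Delta\otimes\mathrm{Id}_C)\circ\Delta$. A coderivation of $C$ is a linear map $\psi_C:C\to C$ with $\Delta\circ\psi_C=(\psi_C\otimes\mathrm{Id}_C)\circ\Delta+(\mathrm{Id}_C\otimes\psi_C)\circ\Delta$. A Coder pair $(C,\psi_C)$ is a coassociative coalgebra $C$ with a coderivation $\psi_C$. Cochain complex of $(C,\psi_C)$ with coefficients in itself (the coadjoint bicomodule): for $m\ge 0$ let $C_c^m(C,C)=\mathrm{Hom}(C,C^{\otimes m})$ and, for $f\in C_c^m(C,C)$, $$\delta_c(f)=(\mathrm{Id}_C\otimes f)\circ\Delta+\sum_{i=1}^m(-1)^i(\mathrm{Id}_{C^{\otimes(i-1)}}\otimes\Delta\otimes\mathrm{Id}_{C^{\otimes(m-i)}})\circ f+(-1)^{m+1}(f\otimes\mathrm{Id}_C)\circ\Delta\in C_c^{m+1}(C,C).$$ For $m\ge1$ let $\omega:C_c^m(C,C)\to C_c^m(C,C)$, $\omega(f)=\sum_{i=1}^m(\mathrm{Id}_{C^{\otimes(i-1)}}\otimes\psi_C\otimes\mathrm{Id}_{C^{\otimes(m-i)}})\circ f-f\circ\psi_C$. Set $C^0_{\mathrm{Coder}}(C,C)=0$, $C^1_{\mathrm{Coder}}(C,C)=\mathrm{Hom}(C,C)$,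 and $C^m_{\mathrm{Coder}}(C,C)=C_c^m(C,C)\times C_c^{m-1}(C,C)$ for $m\ge2$, with differential $d_c^1(f)=(\delta_c(f),-\omega(f))$ and $d_c^m(f,g)=(\delta_c(f),\delta_c(g)+(-1)^m\omega(f))$ for $m\ge2$. An $m$-cocycle is an element of $\ker d_c^m$. A deformation of order $n$ of $(C,\psi_C)$ is a pair $(\Delta_t,\psi_t)$ with $\Delta_t=\sum_{i=0}^n\Delta_it^i$, $\psi_t=\sum_{i=0}^n\psi_it^i$, $\Delta_i\in\mathrm{Hom}(C,C^{\otimes2})$, $\psi_i\in\mathrm{Hom}(C,C)$, $(\Delta_0,\psi_0)=(\Delta,\psi_C)$, such that $(\mathrm{Id}_C\otimes\Delta_t)\circ\Delta_t=(\Delta_t\otimes\mathrm{Id}_C)\circ\Delta_t$ and $\Delta_t\circ\psi_t=(\psi_t\otimes\mathrm{Id}_C)\circ\Delta_t+(\mathrm{Id}_C\otimes\psi_t)\circ\Delta_t$ both hold modulo $t^{n+1}$ (i.e. the coefficients of $t^k$ on both sides agree for $0\le k\le n$). *)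

(* Defs.v *)
From HB Require Import structures.
From mathcomp Require Import all_boot all_order all_algebra.
From mathcomp Require Import boolp.

Set Implicit Arguments.
Unset Strict Implicit.
Unset Printing Implicit Defensive.

Import GRing.Theory.
Local Open Scope ring_scope.
Local Open Scope quotient_scope.

(* Hom(U, V) is the type {linear U -> V}, made into a vector space for the
   pointwise operations. *)
Section LinearMaps.
Variables (F : fieldType) (U V : lmodType F).
Implicit Types f g h : {linear U -> V}.

Lemma linear_ext f g : f =1 g -> f = g.
Proof.
case: f g => f [[a] [b]] [g [[a'] [b']]] /= /funext fg.
rewrite {}fg in a b *.
by rewrite (Prop_irrelevance a a') (Prop_irrelevance b b').
Qed.

HB.instance Definition _ := gen_eqMixin {linear U -> V}.
HB.instance Definition _ := gen_choiceMixin {linear U -> V}.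

Definition lin0 : {linear U -> V} := \0.
Definition lin_add f g : {linear U -> V} := f \+ g.
Definition lin_opp f : {linear U -> V} := \- f.
Definition lin_scale (a : F) f : {linear U -> V} := a \*: f.

Fact lin_addA : associative lin_add.
Proof. by move=> f g h; apply: linear_ext => x /=; rewrite addrA. Qed.
Fact lin_addC : commutative lin_add.
Proof. by move=> f g; apply: linear_ext => x /=; rewrite addrC. Qed.
Fact lin_add0 : left_id lin0 lin_add.
Proof. by move=> f; apply: linear_ext => x /=; rewrite add0r. Qed.
Fact lin_addN : left_inverse lin0 lin_opp lin_add.
Proof. by move=> f; apply: linear_ext => x /=; rewrite addNr. Qed.

HB.instance Definition _ :=
  GRing.isZmodule.Build {linear U -> V} lin_addA lin_addC lin_add0 lin_addN.

Fact lin_scaleA a b f : lin_scale a (lin_scale b f) = lin_scale (a * b) f.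
Proof. by apply: linear_ext => x /=; rewrite scalerA. Qed.
Fact lin_scale1 : left_id 1 lin_scale.
Proof. by move=> f; apply: linear_ext => x /=; rewrite scale1r. Qed.
Fact lin_scaleDr : right_distributive lin_scale +%R.
Proof. by move=> a f g; apply: linear_ext => x /=; rewrite scalerDr. Qed.
Fact lin_scaleDl f : {morph lin_scale^~ f : a b / a + b}.
Proof. by move=> a b; apply: linear_ext => x /=; rewrite scalerDl. Qed.

HB.instance Definition _ := GRing.Zmodule_isLmodule.Build F {linear U -> V}
  lin_scaleA lin_scale1 lin_scaleDr lin_scaleDl.

Lemma lin0E x : (0 : {linear U -> V}) x = 0. Proof. by []. Qed.
Lemma linDE f g x : (f + g) x = f x + g x. Proof. by []. Qed.
Lemma linNE f x : (- f) x = - f x. Proof. by []. Qed.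
Lemma linBE f g x : (f - g) x = f x - g x. Proof. by []. Qed.
Lemma linZE a f x : (a *: f) x = a *: f x. Proof. by []. Qed.
Lemma lin_sumE I r (P : pred I) (f : I -> {linear U -> V}) x :
  (\sum_(i <- r | P i) f i) x = \sum_(i <- r | P i) f i x.
Proof. by elim/big_rec2: _ => //= i y z _ <-. Qed.

End LinearMaps.

Definition lcomp (F : fieldType) (U V W : lmodType F)
  (g : {linear V -> W}) (f : {linear U -> V}) : {linear U -> W} := g \o f.
Notation "g \oL f" := (lcomp g f) (at level 40, left associativity) : ring_scope.

Definition lid (F : fieldType) (U : lmodType F) : {linear U -> U} := idfun.
Notation "'Id_ U" := (@lid _ U) (at level 8, U at level 2, format "''Id_' U")
  : ring_scope.

(* The tensor product of U and V: formal finite sums of pairs (u, v), modulo the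
   smallest additive congruence making (u, v) additive in each variable and
   balanced. The scalars act on the left factor. The universal property is
   proved below (tlift_tens and tensor_ext). *)
Section Tensor.
Variables (F : fieldType) (U V : lmodType F).

Inductive tensor_rel : seq (U * V) -> seq (U * V) -> Prop :=
| TRefl s : tensor_rel s s
| TSym s t : tensor_rel s t -> tensor_rel t s
| TTrans s t r : tensor_rel s t -> tensor_rel t r -> tensor_rel s r
| TCat s s' t t' :
    tensor_rel s s' -> tensor_rel t t' -> tensor_rel (s ++ t) (s' ++ t')
| TComm s t : tensor_rel (s ++ t) (t ++ s)
| TZero v : tensor_rel [:: (0, v)] [::]
| TAddl u u' v : tensor_rel [:: (u + u', v)] [:: (u, v); (u', v)]
| TAddr u v v' : tensor_rel [:: (u, v + v')] [:: (u, v); (u, v')]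
| TScale a u v : tensor_rel [:: (a *: u, v)] [:: (u, a *: v)].

Definition tensor_eqv (s t : seq (U * V)) : bool := `[< tensor_rel s t >].

Fact tensor_eqv_refl : reflexive tensor_eqv.
Proof. by move=> s; apply/asboolP; exact: TRefl. Qed.
Fact tensor_eqv_sym : symmetric tensor_eqv.
Proof. by move=> s t; apply/asboolP/asboolP; exact: TSym. Qed.
Fact tensor_eqv_trans : transitive tensor_eqv.
Proof. by move=> t s r /asboolP st /asboolP tr; apply/asboolP; exact: TTrans tr. Qed.

Canonical tensor_equiv :=
  EquivRel tensor_eqv tensor_eqv_refl tensor_eqv_sym tensor_eqv_trans.

Definition tensor_type : Type := {eq_quot tensor_equiv}.
HB.instance Definition _ := Choice.on tensor_type.
HB.instance Definition _ := Quotient.on tensor_type.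

Definition tsum (s : seq (U * V)) : tensor_type := \pi_tensor_type s.

Lemma tsum_eqP s t : tsum s = tsum t <-> tensor_rel s t.
Proof.
split=> [/eqmodP/asboolP // | st]; by apply/eqmodP/asboolP.
Qed.

Lemma tsum_repr x : tsum (repr x) = x. Proof. exact: reprK. Qed.

Lemma repr_tsum s : tensor_rel (repr (tsum s)) s.
Proof. by apply/tsum_eqP; rewrite tsum_repr. Qed.

Definition tensor_add (x y : tensor_type) : tensor_type := tsum (repr x ++ repr y).
Definition tensor_scale (a : F) (x : tensor_type) : tensor_type :=
  tsum [seq (a *: p.1, p.2) | p <- repr x].
Definition tensor_opp (x : tensor_type) : tensor_type := tensor_scale (-1) x.

Lemma tensor_rel_scale a s t : tensor_rel s t ->
  tensor_rel [seq (a *: p.1, p.2) | p <- s] [seq (a *: p.1, p.2) | p <- t].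
Proof.
elim=> {s t} [s|s t _|s t r _ st _|s s' t t' _ ss _ tt'|s t|v|u u' v|u v v'|b u v] /=.
- exact: TRefl.
- exact: TSym.
- exact: TTrans.
- by rewrite !map_cat; exact: TCat.
- by rewrite !map_cat; exact: TComm.
- by rewrite scaler0; exact: TZero.
- by rewrite scalerDr; exact: TAddl.
- exact: TAddr.
- by rewrite scalerA mulrC -scalerA; exact: TScale.
Qed.

Lemma tensor_addE s t : tensor_add (tsum s) (tsum t) = tsum (s ++ t).
Proof. by apply/tsum_eqP; apply: TCat; exact: repr_tsum. Qed.

Lemma tensor_scaleE a s :
  tensor_scale a (tsum s) = tsum [seq (a *: p.1, p.2) | p <- s].
Proof. by apply/tsum_eqP; apply: tensor_rel_scale; exact: repr_tsum. Qed.

Lemma tsumP (P : tensor_type -> Prop) : (forall s, P (tsum s)) -> forall x, P x.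
Proof. by move=> Ps x; rewrite -(tsum_repr x). Qed.

Fact tensor_addA : associative tensor_add.
Proof.
by elim/tsumP=> r; elim/tsumP=> s; elim/tsumP=> t; rewrite !tensor_addE catA.
Qed.
Fact tensor_addC : commutative tensor_add.
Proof.
elim/tsumP=> s; elim/tsumP=> t; rewrite !tensor_addE.
by apply/tsum_eqP; exact: TComm.
Qed.
Fact tensor_add0 : left_id (tsum [::]) tensor_add.
Proof. by elim/tsumP=> s; rewrite tensor_addE. Qed.

Fact tensor_scaleA a b x :
  tensor_scale a (tensor_scale b x) = tensor_scale (a * b) x.
Proof.
elim/tsumP: x => s; rewrite !tensor_scaleE -map_comp; congr tsum.
by apply: eq_map => p /=; rewrite scalerA.
Qed.
Fact tensor_scale1 : left_id 1 tensor_scale.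
Proof.
elim/tsumP=> s; rewrite tensor_scaleE; congr tsum.
by rewrite -[RHS]map_id; apply: eq_map => -[u v] /=; rewrite scale1r.
Qed.
Fact tensor_scaleDr : right_distributive tensor_scale tensor_add.
Proof.
move=> a; elim/tsumP=> s; elim/tsumP=> t.
by rewrite !(tensor_addE, tensor_scaleE) map_cat.
Qed.
Fact tensor_scaleDl x :
  {morph tensor_scale^~ x : a b / a + b >-> tensor_add a b}.
Proof.
move=> a b; elim/tsumP: x => s; rewrite !(tensor_addE, tensor_scaleE).
apply/tsum_eqP; elim: s => [|[u v] s IHs] /=; first exact: TRefl.
apply: (@TTrans _ (([:: (a *: u, v); (b *: u, v)]) ++
  ([seq (a *: p.1, p.2) | p <- s] ++ [seq (b *: p.1, p.2) | p <- s]))).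
  by rewrite -cat1s; apply: TCat => //; rewrite scalerDl; exact: TAddl.
rewrite /= -cat1s -[X in tensor_rel _ X]cat1s.
apply: TCat; first exact: TRefl.
rewrite -cat1s catA -[_ :: map _ _]cat1s catA.
by apply: TCat; [exact: TComm | exact: TRefl].
Qed.
Fact tensor_addN : left_inverse (tsum [::]) tensor_opp tensor_add.
Proof.
move=> x; rewrite -[X in tensor_add _ X]tensor_scale1 /tensor_opp.
rewrite -tensor_scaleDl addNr; elim/tsumP: x => s; rewrite tensor_scaleE.
apply/tsum_eqP; elim: s => [|[u v] s IHs] /=; first exact: TRefl.
rewrite scale0r -cat1s -[X in tensor_rel _ X]cat0s.
by apply: TCat => //; exact: TZero.
Qed.

HB.instance Definition _ := GRing.isZmodule.Build tensor_type
  tensor_addA tensor_addC tensor_add0 tensor_addN.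
HB.instance Definition _ := GRing.Zmodule_isLmodule.Build F tensor_type
  tensor_scaleA tensor_scale1 tensor_scaleDr tensor_scaleDl.

Definition tensor : lmodType F := GRing.Lmodule.clone F tensor_type _.

Definition tens (u : U) (v : V) : tensor := tsum [:: (u, v)].

Lemma tsum_sum s : tsum s = \sum_(p <- s) tens p.1 p.2.
Proof.
elim: s => [|[u v] s IHs]; first by rewrite big_nil.
by rewrite big_cons -IHs /= /tens; exact/esym/tensor_addE.
Qed.

Lemma tensP (P : tensor -> Prop) :
  (forall s : seq (U * V), P (\sum_(p <- s) tens p.1 p.2)) -> forall x, P x.
Proof. by move=> Ps; elim/tsumP=> s; rewrite tsum_sum. Qed.

Fact tens_bilinear : bilinear_for *:%R *:%R tens.
Proof.
split=> [v a u u' | u a v v'] /=; rewrite /tens.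
  transitivity (tensor_add (tensor_scale a (tens u v)) (tens u' v)) => //.
  by rewrite tensor_scaleE tensor_addE; apply/tsum_eqP; exact: TAddl.
transitivity (tensor_add (tensor_scale a (tens u v)) (tens u v')) => //.
rewrite tensor_scaleE tensor_addE; apply/tsum_eqP; apply: TTrans (TAddr _ _ _) _.
apply: (@TCat [:: _] [:: _] [:: _]); last exact: TRefl.
by apply: TSym; exact: TScale.
Qed.
HB.instance Definition _ :=
  bilinear_isBilinear.Build F U V tensor *:%R *:%R tens tens_bilinear.

Lemma tensor_ext (W : lmodType F) (f g : {linear tensor -> W}) :
  (forall u v, f (tens u v) = g (tens u v)) -> f = g.
Proof.
move=> fg; apply: linear_ext; elim/tensP=> s.
by rewrite !linear_sum; apply: eq_bigr => p _; exact: fg.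
Qed.

Definition tlift_fun (W : lmodType F) (b : U -> V -> W) (x : tensor) : W :=
  \sum_(p <- repr x) b p.1 p.2.

Section Lift.
Variables (W : lmodType F) (b : {bilinear U -> V -> W}).

Lemma tensor_rel_lift s t : tensor_rel s t ->
  \sum_(p <- s) b p.1 p.2 = \sum_(p <- t) b p.1 p.2.
Proof.
elim=> {s t} [s|s t _|s t r _ -> _ ->|s s' t t' _ ss _ tt'|s t|v|u u' v|u v v'|a u v] //.
- by rewrite !big_cat /= ss tt'.
- by rewrite !big_cat /= addrC.
- by rewrite big_seq1 big_nil linear0l.
- by rewrite !big_cons !big_nil !addr0 linearDl.
- by rewrite !big_cons !big_nil !addr0 linearDr.
- by rewrite !big_seq1 linearZl_LR linearZr_LR.
Qed.

Lemma tlift_sum s : tlift_fun b (tsum s) = \sum_(p <- s) b p.1 p.2.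
Proof. by apply: tensor_rel_lift; exact: repr_tsum. Qed.

Fact tlift_linear : linear (tlift_fun b).
Proof.
move=> a; elim/tsumP=> s; elim/tsumP=> t.
transitivity (tlift_fun b (tensor_add (tensor_scale a (tsum s)) (tsum t))) => //.
rewrite tensor_scaleE tensor_addE !tlift_sum big_cat big_map scaler_sumr /=.
by congr (_ + _); apply: eq_bigr => p _; rewrite linearZl_LR.
Qed.
HB.instance Definition _ :=
  GRing.isLinear.Build F tensor W *:%R (tlift_fun b) tlift_linear.

Definition tlift : {linear tensor -> W} := tlift_fun b.

Lemma tlift_tens u v : tlift (tens u v) = b u v.
Proof. by rewrite /= tlift_sum big_seq1. Qed.

End Lift.
End Tensor.

Notation "u \ox v" := (tens u v) (at level 40, left associativity) : ring_scope.

Section TensorMaps.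
Variable F : fieldType.

Section Map.
Variables (U U' V V' : lmodType F).
Variables (f : {linear U -> U'}) (g : {linear V -> V'}).

Definition tmap_fun (u : U) (v : V) : tensor U' V' := f u \ox g v.
Fact tmap_bilinear : bilinear_for *:%R *:%R tmap_fun.
Proof.
by split=> [v a u u' | u a v v'] /=;
  rewrite /tmap_fun linearP ?(linearPl, linearPr).
Qed.
HB.instance Definition _ :=
  bilinear_isBilinear.Build F U V (tensor U' V') *:%R *:%R tmap_fun tmap_bilinear.
Definition tmap : {linear tensor U V -> tensor U' V'} := tlift tmap_fun.

Lemma tmap_tens u v : tmap (u \ox v) = f u \ox g v.
Proof. exact: tlift_tens. Qed.
End Map.

Section Assoc.
Variables (U V W : lmodType F).

Definition tassoc_fun2 (w : W) (u : U) (v : V) : tensor U (tensor V W) :=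
  u \ox (v \ox w).
Fact tassoc_bilinear2 w : bilinear_for *:%R *:%R (tassoc_fun2 w).
Proof.
by split=> [v a u u' | u a v v'] /=;
  rewrite /tassoc_fun2 linearPl ?linearPr.
Qed.
HB.instance Definition _ w := bilinear_isBilinear.Build
  F U V (tensor U (tensor V W)) *:%R *:%R (tassoc_fun2 w) (tassoc_bilinear2 w).

Definition tassoc_fun (x : tensor U V) (w : W) : tensor U (tensor V W) :=
  tlift (tassoc_fun2 w) x.
Fact tassoc_bilinear : bilinear_for *:%R *:%R tassoc_fun.
Proof.
split=> [w a x x' | x a w w'] /=; rewrite /tassoc_fun ?linearP //.
rewrite -linZE -linDE; congr (_ x); congr (GRing.Linear.sort _).
apply: tensor_ext => u v; rewrite linDE linZE !tlift_tens /=.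
by rewrite /tassoc_fun2 !linearPr.
Qed.
HB.instance Definition _ := bilinear_isBilinear.Build
  F (tensor U V) W (tensor U (tensor V W)) *:%R *:%R tassoc_fun tassoc_bilinear.

Definition tassoc : {linear tensor (tensor U V) W -> tensor U (tensor V W)} :=
  tlift tassoc_fun.

Lemma tassoc_tens u v w : tassoc (u \ox v \ox w) = u \ox (v \ox w).
Proof. by rewrite tlift_tens /= /tassoc_fun tlift_tens. Qed.
End Assoc.

Section Unit.
Variable U : lmodType F.

Definition tunitl_fun (a : F^o) (u : U) : U := a *: u.
Fact tunitl_bilinear : bilinear_for *:%R *:%R tunitl_fun.
Proof.
split=> [u a b c | b a u v] /=; rewrite /tunitl_fun.
  by rewrite scalerDl scalerA.
by rewrite scalerDr !scalerA mulrC.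
Qed.
HB.instance Definition _ :=
  bilinear_isBilinear.Build F F^o U U *:%R *:%R tunitl_fun tunitl_bilinear.
Definition tunitl : {linear tensor F^o U -> U} := tlift tunitl_fun.

Lemma tunitl_tens (a : F^o) u : tunitl (a \ox u) = a *: u.
Proof. exact: tlift_tens. Qed.

Definition tunitr_fun (u : U) (a : F^o) : U := a *: u.
Fact tunitr_bilinear : bilinear_for *:%R *:%R tunitr_fun.
Proof.
by split=> [b a u v | u a b c]; rewrite /tunitr_fun; apply tunitl_bilinear.
Qed.
HB.instance Definition _ :=
  bilinear_isBilinear.Build F U F^o U *:%R *:%R tunitr_fun tunitr_bilinear.
Definition tunitr : {linear tensor U F^o -> U} := tlift tunitr_fun.

Lemma tunitr_tens u (a : F^o) : tunitr (u \ox a) = a *: u.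
Proof. exact: tlift_tens. Qed.
End Unit.
End TensorMaps.

(* Tensor powers of C, bracketed to the right: C^{(x)1} = C and
   C^{(x)(m+2)} = C (x) C^{(x)(m+1)}. The usual identifications
   (U (x) V) (x) W = U (x) (V (x) W) and F (x) U = U = U (x) F are made explicit
   as tassoc, tunitl and tunitr. *)
Section TensorPowers.
Variables (F : fieldType) (C : lmodType F).

Fixpoint tpowS (k : nat) : lmodType F :=
  if k is k'.+1 then tensor C (tpowS k') else C.

Definition tpow (m : nat) : lmodType F := if m is k.+1 then tpowS k else F^o.

Definition tcons (m : nat) : {linear tensor C (tpow m) -> tpow m.+1} :=
  if m is k.+1 then 'Id_(tensor C (tpowS k)) else tunitr C.

Fixpoint tsnocS (k : nat) : {linear tensor (tpowS k) C -> tpowS k.+1} :=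
  if k is k'.+1 then tmap 'Id_C (tsnocS k') \oL tassoc C (tpowS k') C
  else 'Id_(tensor C C).

Definition tsnoc (m : nat) : {linear tensor (tpow m) C -> tpow m.+1} :=
  if m is k.+1 then tsnocS k else tunitl C.

(* Id_C (x) f and f (x) Id_C, with values in C^{(x)(m+1)} *)
Definition id_tens (m : nat) (f : {linear C -> tpow m}) :
  {linear tensor C C -> tpow m.+1} := tcons m \oL tmap 'Id_C f.

Definition tens_id (m : nat) (f : {linear C -> tpow m}) :
  {linear tensor C C -> tpow m.+1} := tsnoc m \oL tmap f 'Id_C.

(* Id^{(x)i} (x) D (x) Id^{(x)(m-1-i)} and Id^{(x)i} (x) p (x) Id^{(x)(m-1-i)} on
   C^{(x)m}, for 0 <= i < m (positions are numbered from 0). *)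
Fixpoint comul_atS (D : {linear C -> tensor C C}) (k i : nat) :
    {linear tpowS k -> tpowS k.+1} :=
  match k with
  | 0 => D
  | k'.+1 => if i is i'.+1 then tmap 'Id_C (comul_atS D k' i')
             else tassoc C C (tpowS k') \oL tmap D 'Id_(tpowS k')
  end.

Definition comul_at (D : {linear C -> tensor C C}) (m : nat) :
    'I_m -> {linear tpow m -> tpow m.+1} :=
  match m with 0 => fun=> 0 | k.+1 => fun i => comul_atS D k i end.

Fixpoint coder_atS (p : {linear C -> C}) (k i : nat) : {linear tpowS k -> tpowS k} :=
  match k with
  | 0 => p
  | k'.+1 => if i is i'.+1 then tmap 'Id_C (coder_atS p k' i')
             else tmap p 'Id_(tpowS k')
  end.

Definition coder_at (p : {linear C -> C}) (m : nat) :
    'I_m -> {linear tpow m -> tpow m} :=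
  match m with 0 => fun=> 0 | k.+1 => fun i => coder_atS p k i end.

End TensorPowers.

Section Coder.
Variable F : fieldType.

Definition coassociative (C : lmodType F) (D : {linear C -> tensor C C}) :=
  id_tens (m := 2) D \oL D = tens_id (m := 2) D \oL D.

Definition coderivation (C : lmodType F) (D : {linear C -> tensor C C})
  (p : {linear C -> C}) := D \oL p = tmap p 'Id_C \oL D + tmap 'Id_C p \oL D.

Record coderPair := CoderPair {
  coder_space :> lmodType F;
  comul : {linear coder_space -> tensor coder_space coder_space};
  comul_coassociative : coassociative comul;
  coder : {linear coder_space -> coder_space};
  coder_coderivation : coderivation comul coder
}.

End Coder.

Section Complex.
Variables (F : fieldType) (A : coderPair F).

Definition cochain (m : nat) : lmodType F := {linear A -> tpow A m}.

Definition delta_c (m : nat) (f : cochain m) : cochain m.+1 :=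
  id_tens f \oL comul A
  + \sum_(i < m) (-1) ^+ i.+1 *: (comul_at (comul A) i \oL f)
  + (-1) ^+ m.+1 *: (tens_id f \oL comul A).

Definition omega (m : nat) (f : cochain m) : cochain m :=
  \sum_(i < m) coder_at (coder A) i \oL f - f \oL coder A.

Definition coder_cochain (m : nat) : lmodType F :=
  match m with
  | 0 => 'rV[F]_0
  | 1 => cochain 1
  | k.+1 => (cochain k.+1 * cochain k)%type
  end.

Definition coder_diff (m : nat) : coder_cochain m -> coder_cochain m.+1 :=
  match m with
  | 0 => fun=> 0
  | 1 => fun f : cochain 1 => (delta_c f, - omega f)
  | k.+1 => fun fg : cochain k.+1 * cochain k =>
      (delta_c fg.1, delta_c fg.2 + (-1) ^+ k.+1 *: omega fg.1)
  end.

Definition coder_cocycle (m : nat) (x : coder_cochain m) := coder_diff x = 0.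

End Complex.

(* A deformation of order n is given by its coefficients Delta_i, psi_i for
   0 <= i <= n; the two identities modulo t^(n+1) are compared coefficientwise. *)
Record deformation (F : fieldType) (A : coderPair F) (n : nat) := Deformation {
  Delta : 'I_n.+1 -> {linear A -> tensor A A};
  psi : 'I_n.+1 -> {linear A -> A};
  Delta0 : Delta ord0 = comul A;
  psi0 : psi ord0 = coder A;
  deform_coassociative : forall k : nat, (k <= n)%N ->
    \sum_(i < n.+1) \sum_(j < n.+1 | (i + j == k)%N)
       id_tens (m := 2) (Delta i) \oL Delta j
    = \sum_(i < n.+1) \sum_(j < n.+1 | (i + j == k)%N)
       tens_id (m := 2) (Delta i) \oL Delta j;
  deform_coderivation : forall k : nat, (k <= n)%N ->
    \sum_(i < n.+1) \sum_(j < n.+1 | (i + j == k)%N) Delta i \oL psi j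
    = \sum_(i < n.+1) \sum_(j < n.+1 | (i + j == k)%N)
       (tmap (psi i) 'Id_A \oL Delta j + tmap 'Id_A (psi i) \oL Delta j)
}.

Section Obstruction.
Variables (F : fieldType) (A : coderPair F) (n : nat) (Omega : deformation A n).

Definition Ob_C : cochain A 3 :=
  \sum_(i < n.+1) \sum_(j < n.+1 | [&& i + j == n.+1, 0 < i & 0 < j]%N)
    (tens_id (m := 2) (Delta Omega i) \oL Delta Omega j
     - id_tens (m := 2) (Delta Omega i) \oL Delta Omega j).

Definition Ob_psi : cochain A 2 :=
  \sum_(i < n.+1) \sum_(j < n.+1 | [&& i + j == n.+1, 0 < i & 0 < j]%N)
    (Delta Omega i \oL psi Omega j
     - tmap 'Id_A (psi Omega i) \oL Delta Omega j
     - tmap (psi Omega i) 'Id_A \oL Delta Omega j).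

Definition Ob : coder_cochain A 3 := (Ob_C, Ob_psi).

End Obstruction.

(* Main.v *)
(** If the deformation extended to order [n+1] by [(D, p)], the obstruction would
    be the coboundary of [(D, p)].  In general it is closed by a Bianchi identity.
    Put [a_k] and [b_k] for the coefficients of [t^k] in the failure of
    coassociativity and of the coderivation property.  The expressions obtained
    from [delta_c] and [omega] by letting [Delta_i] and [psi_i] replace
    [Delta_0] and [psi_0], applied to [a_k] and [b_k] and summed over
    [i + k = n+1], vanish identically: expanded as sums over triples of indices,
    their monomials cancel in pairs after permuting the indices.  Since
    [a_k = b_k = 0] for [k <= n], only the term [i = 0] survives, and it is the
    differential of [(a_(n+1), b_(n+1)) = (Ob_C, Ob_psi)]. *)
Require Import Defs.
From mathcomp Require Import all_boot all_order all_algebra.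

Set Implicit Arguments.
Unset Strict Implicit.
Unset Printing Implicit Defensive.

Import GRing.Theory.
Local Open Scope ring_scope.

(** * Sums over index triples with prescribed total *)

Section TripleSums.
Variables (W : zmodType) (n N : nat).
Implicit Types X Y : 'I_n -> 'I_n -> 'I_n -> W.

(** The constraint sits in the summand, not in the index ranges, so that the three sums can be
    exchanged freely. *)
Definition sum3 X : W :=
  \sum_(i < n) \sum_(j < n) \sum_(l < n)
    if (i + j + l == N)%N then X i j l else 0.

Lemma eq_sum3 X Y : (forall i j l, X i j l = Y i j l) -> sum3 X = sum3 Y.
Proof.
move=> XY; do 3![apply: eq_bigr => ? _]; by rewrite XY.
Qed.

Lemma sum3D X Y : sum3 (fun i j l => X i j l + Y i j l) = sum3 X + sum3 Y.
Proof.
rewrite /sum3 -big_split; apply: eq_bigr => i _.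
rewrite -big_split; apply: eq_bigr => j _.
rewrite -big_split; apply: eq_bigr => l _ /=.
by case: ifP; rewrite ?addr0.
Qed.

Lemma sum3N X : sum3 (fun i j l => - X i j l) = - sum3 X.
Proof.
rewrite /sum3 -sumrN; apply: eq_bigr => i _.
rewrite -sumrN; apply: eq_bigr => j _.
rewrite -sumrN; apply: eq_bigr => l _.
by case: ifP; rewrite ?oppr0.
Qed.

Lemma sum3B X Y : sum3 (fun i j l => X i j l - Y i j l) = sum3 X - sum3 Y.
Proof. by rewrite sum3D sum3N. Qed.

Lemma sum3_swap X : sum3 (fun i j l => X j i l) = sum3 X.
Proof.
rewrite /sum3 exchange_big /=; apply: eq_bigr => i _; apply: eq_bigr => j _.
by apply: eq_bigr => l _; rewrite (addnC j i).
Qed.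

Lemma sum3_rot X : sum3 (fun i j l => X j l i) = sum3 X.
Proof.
rewrite /sum3 exchange_big /=; apply: eq_bigr => i _.
rewrite exchange_big /=; apply: eq_bigr => j _. apply: eq_big => // l _.
by rewrite -addnA addnC.
Qed.

(** The constraint on [i + j + l] is symmetric. Both Bianchi identities are brought to this shape:
    [X] cancels against a rotation of its indices, [Y] against a transposition. *)
Lemma sum3_permute_eq0 X Y :
  sum3 (fun i j l => (X j l i - X i j l) + (Y i j l - Y j i l)) = 0.
Proof. by rewrite sum3D !sum3B (sum3_rot X) (sum3_swap Y) !subrr addr0. Qed.

End TripleSums.

(** For [i > 0] the other two indices add up to [n + 1 - i <= n], where the sum of the [f j l]
    vanishes; only [i = 0] contributes. *)
Lemma sum3_lowest (V W : zmodType) n (T : 'I_n.+1 -> V -> W)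
    (f : 'I_n.+1 -> 'I_n.+1 -> V) :
  (forall i, T i 0 = 0) -> (forall i, {morph T i : x y / x + y}) ->
  (forall k, (k <= n)%N ->
    \sum_(i < n.+1) \sum_(j < n.+1 | (i + j == k)%N) f i j = 0) ->
  T ord0 (\sum_(i < n.+1) \sum_(j < n.+1 | (i + j == n.+1)%N) f i j)
  = sum3 n.+1 (fun i j l => T i (f j l)).
Proof.
move=> T0 TD f0; rewrite /sum3 [RHS]big_ord_recl /=.
rewrite [X in _ = _ + X]big1 ?addr0 => [|i _].
  rewrite (big_morph _ (TD _) (T0 _)); apply: eq_bigr => j _.
  rewrite (big_morph _ (TD _) (T0 _)) big_mkcond; apply: eq_bigr => l _.
  by rewrite add0n.
(* The index [lift ord0 i] has value [i + 1], which leaves the total [n - i] for the inner pair. *)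
rewrite -[RHS](T0 (lift ord0 i)) -(f0 (n - i)%N (leq_subr i n)).
rewrite (big_morph _ (TD _) (T0 _)); apply: eq_bigr => j _.
rewrite (big_morph _ (TD _) (T0 _)) [RHS]big_mkcond; apply: eq_bigr => l _.
rewrite -[bump 0 i]/i.+1 -addnA addSn eqSS -[in RHS](eqn_add2l i) subnKC //.
by rewrite ltnW.
Qed.

(** * Composition of linear maps *)

Section Hom.
Variable F : fieldType.
Implicit Types U V W X Y : lmodType F.

Lemma lcompE U V W (g : {linear V -> W}) (f : {linear U -> V}) x :
  (g \oL f) x = g (f x).
Proof. by []. Qed.

Lemma lidE U x : 'Id_U x = x.
Proof. by []. Qed.

Lemma lcompA U V W X (h : {linear W -> X}) (g : {linear V -> W})
  (f : {linear U -> V}) : h \oL (g \oL f) = h \oL g \oL f.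
Proof. exact: linear_ext. Qed.

Lemma lcomp1f U V (f : {linear U -> V}) : 'Id_V \oL f = f.
Proof. exact: linear_ext. Qed.

Lemma lcompf1 U V (f : {linear U -> V}) : f \oL 'Id_U = f.
Proof. exact: linear_ext. Qed.

Lemma lcompDr U V W (g : {linear V -> W}) (f f' : {linear U -> V}) :
  g \oL (f + f') = g \oL f + g \oL f'.
Proof. by apply: linear_ext => x /=; rewrite linearD. Qed.

Lemma lcompNr U V W (g : {linear V -> W}) (f : {linear U -> V}) :
  g \oL - f = - (g \oL f).
Proof. by apply: linear_ext => x /=; rewrite linearN. Qed.

Lemma lcompDl U V W (g g' : {linear V -> W}) (f : {linear U -> V}) :
  (g + g') \oL f = g \oL f + g' \oL f.
Proof. exact: linear_ext. Qed.

Lemma lcompNl U V W (g : {linear V -> W}) (f : {linear U -> V}) :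
  (- g) \oL f = - (g \oL f).
Proof. exact: linear_ext. Qed.

End Hom.

(** * Functoriality of the tensor product and coherence of the associator *)

Section TensorMapTheory.
Variable F : fieldType.
Implicit Types U V W X Y : lmodType F.

Lemma tmap_comp U V W U' V' W' (g : {linear V -> W}) (f : {linear U -> V})
    (g' : {linear V' -> W'}) (f' : {linear U' -> V'}) :
  tmap (g \oL f) (g' \oL f') = tmap g g' \oL tmap f f'.
Proof. by apply: tensor_ext => u v; rewrite /= !tmap_tens. Qed.

Lemma tmap_id U V : tmap 'Id_U 'Id_V = 'Id_(tensor U V).
Proof. by apply: tensor_ext => u v; rewrite /= !tmap_tens. Qed.

Lemma tmap_compl U V W X (g : {linear V -> W}) (f : {linear U -> V}) :
  tmap (g \oL f) 'Id_X = tmap g 'Id_X \oL tmap f 'Id_X.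
Proof. by rewrite -tmap_comp lcomp1f. Qed.

Lemma tmap_compr U V W X (g : {linear V -> W}) (f : {linear U -> V}) :
  tmap 'Id_X (g \oL f) = tmap 'Id_X g \oL tmap 'Id_X f.
Proof. by rewrite -tmap_comp lcomp1f. Qed.

Lemma tmapDr U V U' V' (f : {linear U -> V}) (g g' : {linear U' -> V'}) :
  tmap f (g + g') = tmap f g + tmap f g'.
Proof.
by apply: tensor_ext => u v; rewrite linDE !tmap_tens linDE linearDr.
Qed.

Lemma tmapDl U V U' V' (f : {linear U -> V}) (g g' : {linear U' -> V'}) :
  tmap (g + g') f = tmap g f + tmap g' f.
Proof.
by apply: tensor_ext => u v; rewrite linDE !tmap_tens linDE linearDl.
Qed.

Lemma tmapNr U V U' V' (f : {linear U -> V}) (g : {linear U' -> V'}) :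
  tmap f (- g) = - tmap f g.
Proof.
by apply: tensor_ext => u v; rewrite linNE !tmap_tens linNE linearNr.
Qed.

Lemma tmapNl U V U' V' (f : {linear U -> V}) (g : {linear U' -> V'}) :
  tmap (- g) f = - tmap g f.
Proof.
by apply: tensor_ext => u v; rewrite linNE !tmap_tens linNE linearNl.
Qed.

Lemma tensor_ext3l U V W X (f g : {linear tensor (tensor U V) W -> X}) :
  (forall u v w, f (u \ox v \ox w) = g (u \ox v \ox w)) -> f = g.
Proof.
move=> fg; apply: tensor_ext => x w; elim/tensP: x => s.
by rewrite linear_sumlz !linear_sum; apply: eq_bigr => p _; exact: fg.
Qed.

Lemma tensor_ext4l U V W X Y
    (f g : {linear tensor (tensor (tensor U V) W) X -> Y}) :
  (forall u v w x, f (u \ox v \ox w \ox x) = g (u \ox v \ox w \ox x)) -> f = g.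
Proof.
move=> fg; apply: tensor_ext3l => y w x; elim/tensP: y => s.
by rewrite !linear_sumlz !linear_sum; apply: eq_bigr => p _; exact: fg.
Qed.

Lemma tassoc_natural U U' V V' W W' (f : {linear U -> U'})
    (g : {linear V -> V'}) (h : {linear W -> W'}) :
  tassoc U' V' W' \oL tmap (tmap f g) h = tmap f (tmap g h) \oL tassoc U V W.
Proof.
by apply: tensor_ext3l => u v w; rewrite /= !(tmap_tens, tassoc_tens).
Qed.

Lemma tassoc_pentagon U V W X :
  tmap 'Id_U (tassoc V W X) \oL tassoc U (tensor V W) X
    \oL tmap (tassoc U V W) 'Id_X
  = tassoc U V (tensor W X) \oL tassoc (tensor U V) W X.
Proof.
apply: tensor_ext4l => u v w x.
by rewrite !(lcompE, tmap_tens, tassoc_tens, lidE).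
Qed.

End TensorMapTheory.

(** * Insertions of maps into low tensor powers *)

Section Bianchi.
Variables (F : fieldType) (C : lmodType F).
Local Notation C2 := (tensor C C).
Local Notation C3 := (tensor C C2).
Local Notation C4 := (tensor C C3).
Implicit Types (D E G : {linear C -> C2}) (p : {linear C -> C}).

(** This and the next definitions are [id_tens], [tens_id], [comul_at] and [coder_at] in low degree,
    without trivial rebracketings. Digits give the degree [m], then the position counted from 0. *)
Definition idtens (V : lmodType F) (f : {linear C -> V}) :
  {linear C2 -> tensor C V} := tmap 'Id_C f.
Definition tensid2 D : {linear C2 -> C3} := tassoc C C C \oL tmap D 'Id_C.
Definition tensid3 (f : {linear C -> C3}) : {linear C2 -> C4} :=
  tmap 'Id_C (tassoc C C C) \oL tassoc C C2 C \oL tmap f 'Id_C.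

Definition comul3_0 D : {linear C3 -> C4} := tassoc C C C2 \oL tmap D 'Id_C2.
Definition comul3_1 D : {linear C3 -> C4} := tmap 'Id_C (tensid2 D).
Definition comul3_2 D : {linear C3 -> C4} := tmap 'Id_C (idtens D).

Definition coder2_0 p : {linear C2 -> C2} := tmap p 'Id_C.
Definition coder2_1 p : {linear C2 -> C2} := tmap 'Id_C p.
Definition coder3_0 p : {linear C3 -> C3} := tmap p 'Id_C2.
Definition coder3_1 p : {linear C3 -> C3} := tmap 'Id_C (coder2_0 p).
Definition coder3_2 p : {linear C3 -> C3} := tmap 'Id_C (coder2_1 p).

(** * Commutation relations between insertions *)

Lemma idtens_tensid2 D E : idtens (tensid2 D \oL E) = comul3_1 D \oL idtens E.
Proof. exact: tmap_compr. Qed.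

Lemma idtens_idtens D E : idtens (idtens D \oL E) = comul3_2 D \oL idtens E.
Proof. exact: tmap_compr. Qed.

Lemma idtens_coder2_0 p D : idtens (coder2_0 p \oL D) = coder3_1 p \oL idtens D.
Proof. exact: tmap_compr. Qed.

Lemma idtens_coder2_1 p D : idtens (coder2_1 p \oL D) = coder3_2 p \oL idtens D.
Proof. exact: tmap_compr. Qed.

Lemma idtens_comp p D : idtens (D \oL p) = idtens D \oL coder2_1 p.
Proof. exact: tmap_compr. Qed.

Lemma tensid2_comp p D : tensid2 (D \oL p) = tensid2 D \oL coder2_0 p.
Proof. by rewrite /tensid2 tmap_compl lcompA. Qed.

Lemma tensid2_coder2_0 p D :
  tensid2 (coder2_0 p \oL D) = coder3_0 p \oL tensid2 D.
Proof. by rewrite /tensid2 tmap_compl !lcompA tassoc_natural tmap_id. Qed.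

Lemma tensid2_coder2_1 p D :
  tensid2 (coder2_1 p \oL D) = coder3_1 p \oL tensid2 D.
Proof. by rewrite /tensid2 tmap_compl !lcompA tassoc_natural. Qed.

(** The pentagon identifies the two rebracketings of the fourfold product; naturality then moves [D]
    past the associator. *)
Lemma tensid3_tensid2 D E :
  tensid3 (tensid2 D \oL E) = comul3_0 D \oL tensid2 E.
Proof.
rewrite /tensid3 /tensid2 !tmap_compl !lcompA tassoc_pentagon.
rewrite /comul3_0 -[_ \oL _ \oL tmap (tmap _ _) _]lcompA.
by rewrite tassoc_natural tmap_id !lcompA.
Qed.

Lemma tensid3_idtens D E : tensid3 (idtens D \oL E) = comul3_1 D \oL tensid2 E.
Proof.
rewrite /tensid3 tmap_compl !lcompA -[_ \oL _ \oL tmap (tmap _ _) _]lcompA.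
by rewrite tassoc_natural /comul3_1 /tensid2 tmap_compr !lcompA.
Qed.

(** Interchange law: [D] acts on the left factor and [E] on the right one, so both composites are
    [D] tensored with [E], rebracketed. *)
Lemma comul3_0_idtens D E :
  comul3_0 D \oL idtens E = comul3_2 E \oL tensid2 D.
Proof.
rewrite /comul3_0 /comul3_2 /tensid2 /idtens lcompA -tassoc_natural tmap_id.
by rewrite -!lcompA -!tmap_comp !(lcomp1f, lcompf1).
Qed.

Lemma tensid2_coder2_1r p D :
  tensid2 D \oL coder2_1 p = coder3_2 p \oL tensid2 D.
Proof.
rewrite /coder3_2 /coder2_1 /tensid2 lcompA -tassoc_natural tmap_id.
by rewrite -!lcompA -!tmap_comp !(lcomp1f, lcompf1).
Qed.

Lemma idtens_coder2_0r p D : idtens D \oL coder2_0 p = coder3_0 p \oL idtens D.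
Proof. by rewrite -!tmap_comp !(lcomp1f, lcompf1). Qed.

(** Here and below, [delta_c] and [omega] are made explicit with arbitrary structure maps, so that
    the higher coefficients of a deformation can be inserted. *)
Definition delta3 D (f : {linear C -> C3}) : {linear C -> C4} :=
  idtens f \oL D - comul3_0 D \oL f + comul3_1 D \oL f - comul3_2 D \oL f
  + tensid3 f \oL D.

Definition delta2 D E : {linear C -> C3} :=
  idtens E \oL D - tensid2 D \oL E + idtens D \oL E - tensid2 E \oL D.

Definition omega3 p (f : {linear C -> C3}) : {linear C -> C3} :=
  coder3_0 p \oL f + coder3_1 p \oL f + coder3_2 p \oL f - f \oL p.

Lemma idtensD (V : lmodType F) (f g : {linear C -> V}) :
  idtens (f + g) = idtens f + idtens g.
Proof. exact: tmapDr. Qed.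

Lemma idtensN (V : lmodType F) (f : {linear C -> V}) :
  idtens (- f) = - idtens f.
Proof. exact: tmapNr. Qed.

Lemma tensid2D D E : tensid2 (D + E) = tensid2 D + tensid2 E.
Proof. by rewrite /tensid2 tmapDl lcompDr. Qed.

Lemma tensid2N D : tensid2 (- D) = - tensid2 D.
Proof. by rewrite /tensid2 tmapNl lcompNr. Qed.

Lemma tensid3D f g : tensid3 (f + g) = tensid3 f + tensid3 g.
Proof. by rewrite /tensid3 tmapDl lcompDr. Qed.

Lemma tensid3N f : tensid3 (- f) = - tensid3 f.
Proof. by rewrite /tensid3 tmapNl lcompNr. Qed.

(** Expands into a left-bracketed signed sum of composites, whose terms [AC] can reorder by
    position. *)
Definition linE := (idtensD, idtensN, tensid2D, tensid2N, tensid3D, tensid3N,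
  lcompDl, lcompNl, lcompDr, lcompNr, @opprD, @opprK, @addrA).

Lemma delta3D D : {morph delta3 D : f g / f + g}.
Proof.
move=> f g; rewrite /delta3 !linE.
by rewrite [LHS](AC 10 (1*3*5*7*9*2*4*6*8*10)).
Qed.

Lemma delta2D D : {morph delta2 D : f g / f + g}.
Proof.
move=> f g; rewrite /delta2 !linE.
by rewrite [LHS](AC 8 (1*3*5*7*2*4*6*8)).
Qed.

Lemma omega3D p : {morph omega3 p : f g / f + g}.
Proof.
move=> f g; rewrite /omega3 !linE.
by rewrite [LHS](AC 8 (1*3*5*7*2*4*6*8)).
Qed.

Lemma delta3_0 D : delta3 D 0 = 0.
Proof. by apply: (addrI (delta3 D 0)); rewrite -delta3D !addr0. Qed.

Lemma delta2_0 D : delta2 D 0 = 0.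
Proof. by apply: (addrI (delta2 D 0)); rewrite -delta2D !addr0. Qed.

Lemma omega3_0 p : omega3 p 0 = 0.
Proof. by apply: (addrI (omega3 p 0)); rewrite -omega3D !addr0. Qed.

(** * Bianchi identities for the defects *)

Variables (n : nat) (d : 'I_n -> {linear C -> C2}).
Variable (p : 'I_n -> {linear C -> C}).

(** Summed over [i + j = k], this gives the coefficient [a_k], and [coder_defect] gives [b_k]. *)
Definition coass_defect (i j : 'I_n) : {linear C -> C3} :=
  tensid2 (d i) \oL d j - idtens (d i) \oL d j.

Definition coder_defect (i j : 'I_n) : {linear C -> C2} :=
  d i \oL p j - coder2_1 (p i) \oL d j - coder2_0 (p i) \oL d j.


Lemma sum3_delta3_coass_defect N :
  sum3 N (fun i j l => delta3 (d i) (coass_defect j l)) = 0.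
Proof.
(* [Q j l i] collects the four monomials of [idtens f \oL D] and [tensid3 f \oL D], where [d i] is
   applied first; [P] has insertions on disjoint factors. *)
pose Q i j l :=
  comul3_0 (d i) \oL tensid2 (d j) \oL d l
  - comul3_1 (d i) \oL tensid2 (d j) \oL d l
  + comul3_1 (d i) \oL idtens (d j) \oL d l
  - comul3_2 (d i) \oL idtens (d j) \oL d l.
pose P i j l := comul3_0 (d i) \oL idtens (d j) \oL d l.
rewrite -(sum3_permute_eq0 N Q P); apply: eq_sum3.
move=> i j l; rewrite /Q /P /delta3 /coass_defect !linE.
(* Fixing [d j] restricts the interchange to the transposed term [P j i l]. *)
rewrite tensid3_tensid2 tensid3_idtens (comul3_0_idtens (d j)).
rewrite idtens_tensid2 idtens_idtens !lcompA.
by rewrite [LHS](AC 10 (9*10*1*2*3*5*6*8*4*7)).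
Qed.

Lemma sum3_delta2_coder_defect N :
  sum3 N (fun i j l => delta2 (d i) (coder_defect j l))
  = sum3 N (fun i j l => omega3 (p i) (coass_defect j l)).
Proof.
(* [Q j l i] collects the monomials in which [d i] or [p i] is applied first; [P] those on disjoint
   factors, written with [p] applied last. *)
pose Q i j l :=
  idtens (d i) \oL coder2_1 (p j) \oL d l
  - coder3_2 (p i) \oL idtens (d j) \oL d l
  - coder3_1 (p i) \oL idtens (d j) \oL d l
  - tensid2 (d i) \oL coder2_0 (p j) \oL d l
  + coder3_1 (p i) \oL tensid2 (d j) \oL d l
  + coder3_0 (p i) \oL tensid2 (d j) \oL d l
  - idtens (d i) \oL d j \oL p l + tensid2 (d i) \oL d j \oL p l.
pose P i j l :=
  coder3_2 (p j) \oL tensid2 (d i) \oL d l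
  - coder3_0 (p j) \oL idtens (d i) \oL d l.
apply/eqP; rewrite -subr_eq0 -sum3B; apply/eqP.
rewrite -(sum3_permute_eq0 N Q P); apply: eq_sum3.
move=> i j l; rewrite /Q /P /delta2 /omega3 /coass_defect /coder_defect !linE.
rewrite !(tensid2_comp, tensid2_coder2_1, tensid2_coder2_0).
rewrite !(idtens_comp, idtens_coder2_1, idtens_coder2_0) !lcompA.
rewrite tensid2_coder2_1r idtens_coder2_0r !lcompA.
by rewrite [LHS](AC 20 (1*2*3*10*11*12*20*19*8*18*16*6*15*13*7*4*5*9*17*14)).
Qed.

End Bianchi.

(** * The obstruction of a deformation *)

Section Cocycle.
Variables (F : fieldType) (A : coderPair F).

Lemma id_tens2E (D : {linear A -> tensor A A}) : id_tens (m := 2) D = idtens D.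
Proof. exact: lcomp1f. Qed.

Lemma tens_id2E (D : {linear A -> tensor A A}) : tens_id (m := 2) D = tensid2 D.
Proof. by rewrite /tens_id /= tmap_id lcomp1f. Qed.

Lemma delta_c3E (f : cochain A 3) : delta_c f = delta3 (comul A) f.
Proof.
rewrite /delta_c !big_ord_recl big_ord0 /delta3.
rewrite /id_tens /tens_id /= tmap_id !lcomp1f.
by rewrite !exprS expr0 !mulr1 !mulN1r !opprK !scaleN1r !scale1r addr0 !addrA.
Qed.

Lemma delta_c2E (f : cochain A 2) : delta_c f = delta2 (comul A) f.
Proof.
rewrite /delta_c !big_ord_recl big_ord0 /delta2 id_tens2E tens_id2E.
by rewrite !exprS expr0 !mulr1 !mulN1r !opprK !scaleN1r !scale1r addr0 !addrA.
Qed.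

Lemma omega3E (f : cochain A 3) : omega f = omega3 (coder A) f.
Proof. by rewrite /omega !big_ord_recl big_ord0 addr0 addrA. Qed.

Variables (n : nat) (Omega : deformation A n).
Local Notation a := (coass_defect (Delta Omega)).
Local Notation b := (coder_defect (Delta Omega) (psi Omega)).

(** Two indices at most [n] with total [n + 1] are both positive, so the obstruction is the whole
    coefficient [a_(n+1)]. *)
Lemma Ob_CE :
  Ob_C Omega = \sum_(i < n.+1) \sum_(j < n.+1 | (i + j == n.+1)%N) a i j.
Proof.
apply: eq_bigr => i _; apply: eq_big => [j|j _].
  case: eqP => //= ij; rewrite -(ltn_add2r j) -(ltn_add2l i 0) ij !addn0 add0n.
  by rewrite !ltn_ord.
by rewrite tens_id2E id_tens2E.
Qed.

Lemma Ob_psiE :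
  Ob_psi Omega = \sum_(i < n.+1) \sum_(j < n.+1 | (i + j == n.+1)%N) b i j.
Proof.
apply: eq_bigr => i _; apply: eq_bigl => j.
case: eqP => //= ij; rewrite -(ltn_add2r j) -(ltn_add2l i 0) ij !addn0 add0n.
by rewrite !ltn_ord.
Qed.

Lemma coass_defect_eq0 k : (k <= n)%N ->
  \sum_(i < n.+1) \sum_(j < n.+1 | (i + j == k)%N) a i j = 0.
Proof.
move=> kn; have /esym/eqP := deform_coassociative Omega kn.
rewrite -subr_eq0 -sumrB => /eqP dd; rewrite -[RHS]dd; apply: eq_bigr => i _.
by rewrite -sumrB; apply: eq_bigr => j _; rewrite tens_id2E id_tens2E.
Qed.

Lemma coder_defect_eq0 k : (k <= n)%N ->
  \sum_(i < n.+1) \sum_(j < n.+1 | (i + j == k)%N) b i j = 0.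
Proof.
move=> kn; have /eqP := deform_coderivation Omega kn.
rewrite -subr_eq0 -sumrB => /eqP dp; rewrite -[RHS]dp; apply: eq_bigr => i _.
by rewrite -sumrB; apply: eq_bigr => j _; rewrite opprD addrA addrAC.
Qed.

Lemma delta_c_Ob_C : delta_c (Ob_C Omega) = 0.
Proof.
(* With [Delta ord0] for [comul A], this is the [i = 0] part of the first triple sum. *)
rewrite delta_c3E -(Delta0 Omega) Ob_CE.
rewrite -[RHS](sum3_delta3_coass_defect (Delta Omega) n.+1).
apply: (sum3_lowest (T := fun i => delta3 (Delta Omega i))) coass_defect_eq0
  => i.
  exact: delta3_0.
exact: delta3D.
Qed.

(** Both sides are the [i = 0] parts of the triple sums equated by the second Bianchi identity. *)
Lemma delta_c_Ob_psi : delta_c (Ob_psi Omega) = omega (Ob_C Omega).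
Proof.
rewrite delta_c2E omega3E -(Delta0 Omega) -(psi0 Omega) Ob_CE Ob_psiE.
transitivity (sum3 n.+1 (fun i j l => delta2 (Delta Omega i) (b j l))).
  apply: (sum3_lowest (T := fun i => delta2 (Delta Omega i))) coder_defect_eq0
    => i.
    exact: delta2_0.
  exact: delta2D.
rewrite sum3_delta2_coder_defect; apply/esym.
apply: (sum3_lowest (T := fun i => omega3 (psi Omega i))) coass_defect_eq0
  => i.
  exact: omega3_0.
exact: omega3D.
Qed.

End Cocycle.

Theorem proposition4p2 (F : fieldType) (charF0 : [pchar F]%R =i pred0)
    (n : nat) (n_ge1 : (1 <= n)%N) (A : coderPair F) (Omega : deformation A n) :
  coder_cocycle (A := A) (m := 3) (Ob Omega).
Proof.
rewrite /coder_cocycle /= delta_c_Ob_C delta_c_Ob_psi.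
(* In degree 3 the sign of [omega] is -1, so the second component is a difference of equal terms. *)
by rewrite !exprS expr0 !mulr1 !mulN1r opprK scaleN1r subrr.
Qed.
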